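(* Let $\mathbb{K}\subset\mathbb{C}$ be a field. Every formal matrix $A(x)=A_0+(\text{terms of orders}>0)$ in $Mat(m,n,p)$, with $A_0\in\mathrm{Mat}(m\times n,\mathbb{K})$, is two-sided equivalent to a matrix $B(x)=A_0+b(x)$, $b\in Mat(m,n,p)$, satisfying $A_0^*b(x)=0$ and $b(x)A_0^*=0$.
   Context: $m,n,p\ge 1$ are integers. $Mat(m,n,p)$ is the space of $m\times n$ matrices with entries in $\mathbb{K}[[x_1,\dots,x_p]]$. Two matrices $A,B\in Mat(m,n,p)$ are two-sided equivalent if $B(x)=U(x)A(x)V^{-1}(x)$ for some $U\in GL(m,\mathbb{K}[[x_1,\dots,x_p]])$, $V\in GL(n,\mathbb{K}[[x_1,\dots,x_p]])$. For a constant matrix $A_0$, $A_0^*=\overline{A_0^T}$ is the conjugate transpose.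
   Formalization: The formal theorem additionally assumes that the conjugate transpose A_0^* has entries in K (automatic if K is closed under conjugation or A_0 is real); without it the claim fails, e.g. K=Q(w), w=2^{1/3}e^{2πi/3}, A_0=[[1,0],[w,0]], A=[[1,0],[w,x_1]]. *)

(* Defs.v *)
From HB Require Import structures.
From mathcomp Require Import all_boot all_order all_algebra.
From mathcomp Require Export sesquilinear spectral complex mpoly.
From mathcomp Require Import boolp.
From mathcomp Require Export reals.
Set Implicit Arguments.
Unset Strict Implicit.
Unset Printing Implicit Defensive.
Import GRing.Theory.
Local Open Scope ring_scope.

(* K[[x_1, ..., x_p]]: a power series is its family of coefficients, indexed
   by the multi-exponents m : 'X_{1..p}. *)
Record fps (K : comNzRingType) (p : nat) := FPS { fps_coef : 'X_{1..p} -> K }.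

Section PowerSeriesRing.
Variables (K : comNzRingType) (p : nat).
Implicit Types (f g h : fps K p) (m : 'X_{1..p}).

Lemma fpsP f g : fps_coef f =1 fps_coef g -> f = g.
Proof. by case: f g => [u] [v] /= /funext ->. Qed.

HB.instance Definition _ := gen_eqMixin (fps K p).
HB.instance Definition _ := gen_choiceMixin (fps K p).

Definition fps_zero : fps K p := FPS (fun=> 0).
Definition fps_opp f : fps K p := FPS (fun m => - fps_coef f m).
Definition fps_add f g : fps K p := FPS (fun m => fps_coef f m + fps_coef g m).

Fact fps_addA : associative fps_add.
Proof. by move=> f g h; apply: fpsP => m /=; rewrite addrA. Qed.
Fact fps_addC : commutative fps_add.
Proof. by move=> f g; apply: fpsP => m /=; rewrite addrC. Qed.
Fact fps_add0 : left_id fps_zero fps_add.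
Proof. by move=> f; apply: fpsP => m /=; rewrite add0r. Qed.
Fact fps_addN : left_inverse fps_zero fps_opp fps_add.
Proof. by move=> f; apply: fpsP => m /=; rewrite addNr. Qed.
HB.instance Definition _ :=
  GRing.isZmodule.Build (fps K p) fps_addA fps_addC fps_add0 fps_addN.

Definition fpsC (c : K) : fps K p := FPS (fun m => if m == 0%MM then c else 0).

(* Cauchy product. The bound (mdeg m).+1 only makes the index type finite:
   k <= m implies mdeg k <= mdeg m. *)
Definition fps_mul f g : fps K p :=
  FPS (fun m => \sum_(k : 'X_{1..p < (mdeg m).+1} | (k <= m)%MM)
                   fps_coef f k * fps_coef g (m - k)%MM).

(* The ring axioms are transported from {mpoly K[p]} by truncation. *)
Definition fps_trunc d f : {mpoly K[p]} :=
  \sum_(k : 'X_{1..p < d}) fps_coef f k *: 'X_[k].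

Lemma fps_truncE d f m : (mdeg m < d)%N -> (fps_trunc d f)@_m = fps_coef f m.
Proof. by move=> ltmd; rewrite /fps_trunc mcoeff_mpoly. Qed.

Lemma fps_mulE d f g m : (mdeg m < d)%N ->
  fps_coef (fps_mul f g) m = (fps_trunc d f * fps_trunc d g)@_m.
Proof.
move=> ltmd; rewrite (mcoeff_poly_mul_lin _ _ (ltnSn (mdeg m))) /=.
apply: eq_bigr => k lekm; rewrite !fps_truncE //.
  by rewrite (leq_ltn_trans _ ltmd) // mdegB.
by rewrite (leq_ltn_trans _ ltmd) // -ltnS bmdeg.
Qed.

Fact fps_mulA : associative fps_mul.
Proof.
move=> f g h; apply: fpsP => m.
pose d := (mdeg m).+1.
have le_d (k : 'X_{1..p < d}) : (mdeg (m - k)%MM < d)%N by rewrite ltnS mdegB.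
transitivity ((fps_trunc d f * (fps_trunc d g * fps_trunc d h))@_m).
  rewrite (mcoeff_poly_mul_lin _ _ (ltnSn (mdeg m))) /=.
  by apply: eq_bigr => k _; rewrite fps_truncE ?bmdeg // -fps_mulE.
rewrite mulrA (mcoeff_poly_mul_lin _ _ (ltnSn (mdeg m))) /=.
by apply: eq_bigr => k _; rewrite (fps_truncE h) // -fps_mulE ?bmdeg.
Qed.

Fact fps_mulC : commutative fps_mul.
Proof.
by move=> f g; apply: fpsP => m; rewrite !(fps_mulE _ _ (ltnSn _)) mulrC.
Qed.

Fact fps_mul1 : left_id (fpsC 1) fps_mul.
Proof.
move=> f; apply: fpsP => m; rewrite (fps_mulE _ _ (ltnSn _)).
have -> : fps_trunc (mdeg m).+1 (fpsC 1) = 1.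
  apply/mpolyP => k; rewrite mcoeff1.
  have [ltk|] := ltnP (mdeg k) (mdeg m).+1.
    by rewrite fps_truncE //=; case: (k == 0%MM).
  rewrite /fps_trunc raddf_sum /= => lek; rewrite big1 => [|i _].
    by case: eqP lek => // ->; rewrite mdeg0.
  rewrite mcoeffZ mcoeffX; case: (bmnm i =P k) => [ik|_]; last exact: mulr0.
  by move: lek; rewrite -ik leqNgt bmdeg.
by rewrite mul1r fps_truncE.
Qed.

Fact fps_mulDl : left_distributive fps_mul fps_add.
Proof.
move=> f g h; apply: fpsP => m /=; rewrite -big_split /=.
by apply: eq_bigr => k _; rewrite mulrDl.
Qed.

Fact fps_one_neq0 : fpsC 1 != 0.
Proof.
apply/eqP => /(congr1 (fun f => fps_coef f 0%MM)) /= /eqP.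
by rewrite eqxx oner_eq0.
Qed.

HB.instance Definition _ := GRing.Zmodule_isComNzRing.Build (fps K p)
  fps_mulA fps_mulC fps_mul1 fps_mulDl fps_one_neq0.

(* Units are the elements with a multiplicative inverse, so that
   'M[fps K p]_n : U \in unitmx means U \in GL(n, K[[x_1, ..., x_p]]). *)
Definition fps_unit : {pred fps K p} := fun f => `[< exists g, g * f = 1 >].
Definition fps_inv f : fps K p :=
  if pselect (exists g, g * f = 1) is left e then projT1 (cid e) else f.

Fact fps_mulVx : {in fps_unit, left_inverse 1 fps_inv *%R}.
Proof.
move=> f; rewrite unfold_in /fps_inv => /asboolP uf.
by case: pselect => // e; case: (cid e).
Qed.
Fact fps_unitPl f g : g * f = 1 -> fps_unit f.
Proof. by move=> gf1; apply/asboolP; exists g. Qed.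
Fact fps_inv_out : {in [predC fps_unit], fps_inv =1 id}.
Proof.
move=> f; rewrite inE unfold_in /fps_inv => /asboolP nuf.
by case: pselect.
Qed.
HB.instance Definition _ := GRing.ComNzRing_hasMulInverse.Build (fps K p)
  fps_mulVx fps_unitPl fps_inv_out.

End PowerSeriesRing.

Definition two_sided_equiv (K : comNzRingType) (m n p : nat)
    (A B : 'M[fps K p]_(m, n)) : Prop :=
  exists (U : 'M[fps K p]_m) (V : 'M[fps K p]_n),
    [/\ U \in unitmx, V \in unitmx & B = U *m A *m invmx V].

Definition const_fpsmx (K : comNzRingType) (m n p : nat) (A0 : 'M[K]_(m, n)) :
    'M[fps K p]_(m, n) :=
  map_mx (fun c => fpsC p c) A0.

Definition positive_order (K : comNzRingType) (m n p : nat)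
    (a : 'M[fps K p]_(m, n)) : Prop :=
  forall i j, fps_coef (a i j) 0%MM = 0.

(* The field K inside the complex numbers is given by its embedding iota. A
   subfield of C need not be stable under conjugation, whereas the products
   of A0^* with matrices over K[[x]] require A0^* to be defined over K. This
   cannot be dropped: if w \in K but w^* \notin K, then A0 = (1 0; w 0) and
   A = (1 0; w x_1) have \det A != 0, while A0^* b = 0 with b over K[[x]]
   forces b = 0. *)
Definition is_conj_transpose (R : realType) (K : fieldType)
    (iota : {rmorphism K -> R[i]}) (m n : nat)
    (A0 : 'M[K]_(m, n)) (A0s : 'M[K]_(n, m)) : Prop :=
  (map_mx iota A0s = (map_mx iota A0) ^t*)%sesqui.

(* Main.v *)
Require Import Defs.
From HB Require Import structures.
From mathcomp Require Import all_boot all_order all_algebra.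
From mathcomp Require Import complex reals.
From mathcomp Require Import boolp.
Set Implicit Arguments.
Unset Strict Implicit.
Unset Printing Implicit Defensive.
Import GRing.Theory.
Local Open Scope ring_scope.

(** Why the theorem holds. Write A = A0 + a with a of positive order, and let
    G be the Moore-Penrose inverse of A0, so that A0 G and G A0 are the
    orthogonal projectors onto the image of A0 and of A0^*. A matrix b
    satisfies A0^* b = 0 and b A0^* = 0 as soon as it has the form
    (1 - A0 G) b' (1 - G A0), and A is brought to A0 + b of this form by
    eliminating with A0 as a pivot, as in a Schur complement, but without
    choosing bases:
    - T = 1 + a G has constant term 1, hence is invertible over K[[x]], and
      A = T A0 + a (1 - G A0), so T^-1 A = A0 + c where
      c = T^-1 a (1 - G A0) satisfies c G = 0;
    - because c G = 0, the matrix 1 - G c has inverse 1 + G c, and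
      (A0 + c) (1 - G c) = A0 + (1 - A0 G) c.
    This gives b in closed form (pseudo_inverse_normal_form).

    What remains is that G exists over K itself and not only over C. It does
    because A0^* has its entries in K: G = A0^* M A0^* where M is any
    generalized inverse of A0^* A0 A0^*. That this G has the required
    properties follows from the positivity of the Hermitian form of C, through
    the rule that X A0^* A0 = 0 implies X A0^* = 0 (moore_penrose_inverse and
    mulmx_gram_cancel). *)

(** * Constant terms and units of power series *)

Section PowerSeries.
Variables (K : comNzRingType) (p : nat).
Implicit Types (f g h : fps K p) (k : 'X_{1..p}).

Lemma fps_coefB f g k : fps_coef (f - g) k = fps_coef f k - fps_coef g k.
Proof. by []. Qed.

Lemma fps_coef_sum (I : Type) (r : seq I) (F : I -> fps K p) k :
  fps_coef (\sum_(i <- r) F i) k = \sum_(i <- r) fps_coef (F i) k.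
Proof. exact: (big_morph (fun f => fps_coef f k)). Qed.

Lemma fps_coefM f g k :
  fps_coef (f * g) k = \sum_(l : 'X_{1..p < (mdeg k).+1} | (l <= k)%MM)
                          fps_coef f l * fps_coef g (k - l)%MM.
Proof. by []. Qed.

Lemma fps_coefM0 f g :
  fps_coef (f * g) 0%MM = fps_coef f 0%MM * fps_coef g 0%MM.
Proof.
have lt0 : (mdeg (0%MM : 'X_{1..p}) < (mdeg (0%MM : 'X_{1..p})).+1)%N by [].
rewrite fps_coefM (bigD1 (BMultinom lt0)) /=; last exact: lepm_refl.
rewrite subm0 big1 ?addr0 // => l /andP[/mnm_lepP le0 /eqP ne0].
case: ne0; apply: val_inj; apply/mnmP => i /=.
by apply/eqP; rewrite mnm0E -leqn0 -[X in (_ <= X)%N](mnm0E i) le0.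
Qed.

Definition fps_const_coef f : K := fps_coef f 0%MM.

Fact fps_const_coef_is_zmod : zmod_morphism fps_const_coef.
Proof. by []. Qed.
Fact fps_const_coef_is_monoid : monoid_morphism fps_const_coef.
Proof. by split=> [|f g]; [rewrite /fps_const_coef /= eqxx | exact: fps_coefM0]. Qed.
HB.instance Definition _ :=
  GRing.isZmodMorphism.Build (fps K p) K fps_const_coef fps_const_coef_is_zmod.
HB.instance Definition _ :=
  GRing.isMonoidMorphism.Build (fps K p) K fps_const_coef
    fps_const_coef_is_monoid.

Fact fpsC_is_zmod : zmod_morphism (@fpsC K p).
Proof. by move=> c d; apply: fpsP => k /=; case: ifP; rewrite ?subr0. Qed.
Fact fpsC_is_monoid : monoid_morphism (@fpsC K p).
Proof.
split=> // c d; apply: fpsP => k; have [->|nz] := eqVneq k 0%MM.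
  by rewrite fps_coefM0 /= eqxx.
rewrite fps_coefM /= (negPf nz) big1 // => l _.
have [->|] := eqVneq (bmnm l) 0%MM; last by rewrite mul0r.
by rewrite subm0 (negPf nz) mulr0.
Qed.
HB.instance Definition _ :=
  GRing.isZmodMorphism.Build K (fps K p) (@fpsC K p) fpsC_is_zmod.
HB.instance Definition _ :=
  GRing.isMonoidMorphism.Build K (fps K p) (@fpsC K p) fpsC_is_monoid.

(** A series without constant term has order at least one, and orders add up
    in products: this is what makes its geometric series converge. *)
Lemma fps_coefX_low f d k :
  fps_coef f 0%MM = 0 -> (mdeg k < d)%N -> fps_coef (f ^+ d) k = 0.
Proof.
move=> f0; elim: d k => // d IHd k; rewrite ltnS => ltkd.
rewrite exprS fps_coefM big1 // => l lekl.
have [->|nz] := eqVneq (bmnm l) 0%MM; first by rewrite f0 mul0r.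
rewrite IHd ?mulr0 //.
apply: leq_trans ltkd; rewrite -[X in (_ < mdeg X)%N](submK lekl) mdegD.
by rewrite -[X in (X < _)%N]addn0 ltn_add2l lt0n mdeg_eq0.
Qed.

(** Coefficients of a product in low degree only see the low degree part of
    the factors, so an infinite sum may be replaced by a partial sum. *)
Lemma eq_fps_coefM f g h k :
  (forall l, (mdeg l <= mdeg k)%N -> fps_coef g l = fps_coef h l) ->
  fps_coef (f * g) k = fps_coef (f * h) k.
Proof.
by move=> eqgh; rewrite !fps_coefM; apply: eq_bigr => l _; rewrite eqgh ?mdegB.
Qed.

(** The inverse of f = 1 - h is the geometric series of h. Its coefficient at
    the monomial k is the finite sum over the powers of h of exponent at most
    the degree of k, as the higher powers do not reach this degree. *)
Lemma fps_const_coef1_unit f : fps_coef f 0%MM = 1 -> f \is a GRing.unit.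
Proof.
move=> f1; pose h := 1 - f.
have h0 : fps_coef h 0%MM = 0 by rewrite fps_coefB f1 /= eqxx subrr.
pose g : fps K p := FPS (fun k => \sum_(i < (mdeg k).+1) fps_coef (h ^+ i) k).
have gE d k : (mdeg k <= d)%N ->
    fps_coef g k = fps_coef (\sum_(i < d.+1) h ^+ i) k.
  move=> lekd; rewrite fps_coef_sum /=.
  rewrite -(big_mkord xpredT (fun i => fps_coef (h ^+ i) k)).
  rewrite -(big_mkord xpredT (fun i => fps_coef (h ^+ i) k)).
  rewrite [RHS](big_cat_nat _ (n := (mdeg k).+1)) //=.
  rewrite [X in _ + X]big_nat_cond [X in _ + X]big1 ?addr0 // => i.
  by case/andP=> /andP[ltki _] _; apply: fps_coefX_low.
apply/asboolP; exists g; apply: fpsP => k.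
(* Up to degree mdeg k, g is a partial sum, and the product telescopes. *)
rewrite mulrC (eq_fps_coefM f (gE (mdeg k))).
have -> : f = - (h - 1) by rewrite /h addrAC subrr add0r opprK.
rewrite mulNr -subrX1 opprB fps_coefB.
by rewrite fps_coefX_low // subr0.
Qed.

(** The determinant commutes with taking constant terms, so here its constant
    term is 1. *)
Lemma unitmx_add1_positive_order n (N : 'M[fps K p]_n) :
  positive_order N -> 1%:M + N \in unitmx.
Proof.
move=> N0; rewrite unitmxE; apply: fps_const_coef1_unit.
rewrite -/(fps_const_coef _) -det_map_mx map_mxD map_mx1.
have -> : map_mx fps_const_coef N = 0.
  by apply/matrixP=> i j; rewrite !mxE; apply: N0.
by rewrite addr0 det1.
Qed.

Lemma positive_order_mulr m n q (M : 'M[fps K p]_(m, n)) (N : 'M_(n, q)) :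
  positive_order M -> positive_order (M *m N).
Proof.
move=> M0 i j; rewrite mxE fps_coef_sum big1 // => l _.
by rewrite fps_coefM0 M0 mul0r.
Qed.

End PowerSeries.

(** * Elimination with a non-invertible pivot *)

(** With T = 1 + a G, left multiplication by T^-1 turns a into
    c = T^-1 a (1 - G A0), which G kills on the right; hence 1 - G c is
    invertible, and right multiplication by it turns c into (1 - A0 G) c. *)
Lemma pseudo_inverse_normal_form (S : comUnitRingType) m n
    (A0 a : 'M[S]_(m, n)) (G : 'M[S]_(n, m)) :
    G *m A0 *m G = G -> 1%:M + a *m G \in unitmx ->
  let b := (1%:M - A0 *m G) *m invmx (1%:M + a *m G) *m a *m (1%:M - G *m A0) in
  exists U V,
    [/\ U \in unitmx, V \in unitmx & A0 + b = U *m (A0 + a) *m invmx V].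
Proof.
move=> GAG uT; set T := 1%:M + a *m G in uT *; move=> b.
pose c := invmx T *m a *m (1%:M - G *m A0).
have cG : c *m G = 0 by rewrite /c -mulmxA mulmxBl mul1mx GAG subrr mulmx0.
have left_step : invmx T *m (A0 + a) = A0 + c.
  have -> : A0 + a = T *m A0 + a *m (1%:M - G *m A0).
    by rewrite mulmxDl mul1mx mulmxBr mulmx1 mulmxA [a - _]addrC addrA addrK.
  by rewrite mulmxDr (mulKmx uT) mulmxA.
have cGinv : (1%:M - G *m c) *m (1%:M + G *m c) = 1%:M.
  rewrite mulmxDr mulmx1 mulmxBl mul1mx (mulmxA (G *m c)).
  by rewrite -(mulmxA G c G) cG mulmx0 mul0mx subr0 subrK.
have [uV' uV] := mulmx1_unit cGinv.
exists (invmx T), (1%:M + G *m c); split; rewrite ?unitmx_inv //.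
have -> : invmx (1%:M + G *m c) = 1%:M - G *m c.
  by rewrite -[RHS](mulmxK uV) cGinv mul1mx.
rewrite left_step mulmxBr mulmx1 mulmxDl (mulmxA c) cG mul0mx addr0.
by rewrite /b -!mulmxA mulmxBl mul1mx -addrA !mulmxA.
Qed.

(** * The Moore-Penrose inverse over a subfield of the complex numbers *)

(** The i-th diagonal entry of Z Z^* is the sum of the squared moduli of the
    i-th row of Z. *)
Lemma mulmx_conj_transpose_eq0 (C : numClosedFieldType) m n (Z : 'M[C]_(m, n)) :
  Z *m (Z ^t*)%sesqui = 0 -> Z = 0.
Proof.
move=> ZZ0; apply/matrixP => i j; rewrite mxE.
have /(congr1 (fun M : 'M_m => M i i)) := ZZ0; rewrite !mxE.
under eq_bigr do rewrite !mxE.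
move/Num.Theory.psumr_eq0P => /(_ (fun k _ => Num.Theory.mul_conjC_ge0 _)).
by move=> /(_ j isT) /eqP; rewrite Num.Theory.mul_conjC_eq0 => /eqP.
Qed.

Section ConjTranspose.
Variables (R : realType) (K : fieldType) (iota : {rmorphism K -> R[i]}).

Lemma conj_transpose_sym m n (A : 'M[K]_(m, n)) (As : 'M[K]_(n, m)) :
  is_conj_transpose iota A As -> is_conj_transpose iota As A.
Proof. by rewrite /is_conj_transpose => ->; rewrite spectral.trmxCK. Qed.

Lemma conj_transpose_tr m n (A : 'M[K]_(m, n)) (As : 'M[K]_(n, m)) :
  is_conj_transpose iota A As -> is_conj_transpose iota A^T As^T.
Proof.
by rewrite /is_conj_transpose => hAs; rewrite -!map_trmx hAs -map_trmx.
Qed.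

(** For D = X - Y, D As A = 0 gives (D As) (D As)^* = D As A D^* = 0, where
    D^* only makes sense over the complex numbers; hence D As = 0. *)
Lemma mulmx_gram_cancel m n q (A : 'M[K]_(m, n)) (As : 'M[K]_(n, m))
    (X Y : 'M[K]_(q, n)) :
  is_conj_transpose iota A As -> X *m As *m A = Y *m As *m A ->
  X *m As = Y *m As.
Proof.
move=> hAs eqXY; apply/eqP; rewrite -subr_eq0 -mulmxBl; apply/eqP.
set D := X - Y.
have DAsA : D *m As *m A = 0.
  by rewrite /D !mulmxBl eqXY subrr.
apply: (map_mx_inj (f := iota)); rewrite map_mx0.
apply: mulmx_conj_transpose_eq0.
rewrite map_mxM {2}hAs trmx_mul (map_mxM Num.conj) spectral.trmxCK.
by rewrite mulmxA -!map_mxM DAsA map_mx0 mul0mx.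
Qed.

Lemma mulmx_gram_cancel_l m n q (A : 'M[K]_(m, n)) (As : 'M[K]_(n, m))
    (X Y : 'M[K]_(m, q)) :
  is_conj_transpose iota A As -> A *m (As *m X) = A *m (As *m Y) ->
  As *m X = As *m Y.
Proof.
move=> hAs /(congr1 trmx); rewrite !trmx_mul => eqXY.
apply: trmx_inj; rewrite !trmx_mul.
exact: mulmx_gram_cancel (conj_transpose_tr hAs) eqXY.
Qed.

(** The classical formula G = As (As A As)^- As, for an arbitrary generalized
    inverse (As A As)^-, stays inside the field of the entries of A and As.
    The last two identities say that b = (1 - A G) b' (1 - G A) satisfies
    As b = 0 and b As = 0. *)
Lemma moore_penrose_inverse m n (A : 'M[K]_(m, n)) (As : 'M[K]_(n, m)) :
    is_conj_transpose iota A As ->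
  exists G : 'M[K]_(n, m),
    [/\ G *m A *m G = G, As *m A *m G = As & G *m A *m As = As].
Proof.
move=> hAs; have hA := conj_transpose_sym hAs.
pose T := As *m A *m As; pose M := pinvmx T.
have TMT : T *m M *m T = T by apply: mulmxKpV; apply: submx_refl.
(* From T M T = T, a factor A As is cancelled on the right here, and a factor
   As A on the left below, each in two Gram steps. *)
have TMAs : T *m M *m As = As.
  rewrite -[RHS]mul1mx; apply: (mulmx_gram_cancel hAs).
  by apply: (mulmx_gram_cancel hA); rewrite mul1mx -[RHS]TMT /T !mulmxA.
have AsMT : As *m (M *m T) = As.
  rewrite -[RHS]mulmx1; apply: (mulmx_gram_cancel_l hAs).
  apply: (mulmx_gram_cancel_l hA).
  by rewrite mulmx1 [RHS]mulmxA -[RHS]TMT /T !mulmxA.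
exists (As *m M *m As); split.
- by rewrite -[X in _ = X *m M *m As]AsMT /T !mulmxA.
- by rewrite -[RHS]TMAs /T !mulmxA.
- by rewrite -[RHS]AsMT /T !mulmxA.
Qed.

End ConjTranspose.

Theorem corollary1p3 (R : realType) (K : fieldType)
    (iota : {rmorphism K -> R[i]}) (m n p : nat)
    (m_ge1 : (1 <= m)%N) (n_ge1 : (1 <= n)%N) (p_ge1 : (1 <= p)%N)
    (A0 : 'M[K]_(m, n)) (A0s : 'M[K]_(n, m))
    (hA0s : is_conj_transpose iota A0 A0s)
    (A : 'M[fps K p]_(m, n)) (hA : positive_order (A - const_fpsmx p A0)) :
  exists b : 'M[fps K p]_(m, n),
    [/\ two_sided_equiv A (const_fpsmx p A0 + b),
        const_fpsmx p A0s *m b = 0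
      & b *m const_fpsmx p A0s = 0].
Proof.
have [G [GAG AsE FAs]] := moore_penrose_inverse hA0s.
have constM q r s (X : 'M[K]_(q, r)) (Y : 'M[K]_(r, s)) :
    const_fpsmx p (X *m Y) = const_fpsmx p X *m const_fpsmx p Y.
  exact: (map_mxM (@fpsC K p)).
have uT := unitmx_add1_positive_order
  (positive_order_mulr (const_fpsmx p G) hA).
have GAGx : const_fpsmx p G *m const_fpsmx p A0 *m const_fpsmx p G =
            const_fpsmx p G by rewrite -!constM GAG.
have [U [V [uU uV eqB]]] := pseudo_inverse_normal_form GAGx uT.
rewrite [const_fpsmx p A0 + (A - _)]addrC subrK in eqB.
eexists; split; first by exists U, V; split; [| | exact: eqB].
  rewrite !mulmxA (mulmxBr (const_fpsmx p A0s)) mulmx1 mulmxA.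
  by rewrite -!constM AsE subrr !mul0mx.
rewrite -[LHS]mulmxA (mulmxBl _ _ (const_fpsmx p A0s)) mul1mx.
by rewrite -!constM FAs subrr mulmx0.
Qed.
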